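(* Let $G$ be a finite simple connected graph with at least two universal vertices. Let $k\geq 3$ and $1\leq m_1\leq m_2\leq\dots\leq m_k$ be integers. Then $$\gamma_{P,c}(G\times K_{m_1,m_2,\dots,m_k})=\begin{cases}2, & \text{if } m_1=m_2=1,\\ 3, & \text{otherwise.}\end{cases}$$
   Context: A universal vertex is a vertex adjacent to every other vertex. Power domination: for $S\subseteq V(X)$, start with $M(S)=N[S]$ and repeatedly add a vertex $w$ whenever some $v\in M(S)$ has $w$ as its unique neighbour outside $M(S)$; $S$ is a connected power dominating set if the final $M(S)$ is $V(X)$ and $\langle S\rangle$ is connected; $\gamma_{P,c}(X)$ is the minimum size of such a set. The tensor product $G\times H$ has vertex set $V(G)\times V(H)$, with $(a,b)\sim(x,y)$ iff $ax\in E(G)$ and $by\in E(H)$. $K_{m_1,\dots,m_k}$ is the complete multipartite graph with partite sets of sizes $m_1,\dots,m_k$.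
   Formalization: When G = K_2 the formal theorem also assumes m_1 = 1 and m_1+...+m_k > 3: the printed formula fails for K_2 × K_{1,1,1} = C_6 (value 1, not 2) and for K_2 with m_1 ≥ 2 (value at least 4, not 3). *)

(* Defs.v *)
From HB Require Import structures.
From mathcomp Require Import all_boot.

Set Implicit Arguments.
Unset Strict Implicit.
Unset Printing Implicit Defensive.

Record sgraph := SGraph {
  vertex :> finType;
  adj : rel vertex;
  adj_sym : symmetric adj;
  adj_irr : irreflexive adj
}.

Definition connected_graph (X : sgraph) : bool :=
  (0 < #|X|) && [forall x : X, forall y : X, connect (@adj X) x y].

Definition universal (X : sgraph) (v : X) : bool :=
  [forall w : X, (w != v) ==> adj v w].

Section Induced.
Variables (X : sgraph) (S : {set X}).

Definition induced_adj : rel {x : X | x \in S} :=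
  fun u v => adj (val u) (val v).

Lemma induced_adj_sym : symmetric induced_adj.
Proof. by move=> u v; apply: adj_sym. Qed.

Lemma induced_adj_irr : irreflexive induced_adj.
Proof. by move=> u; apply: adj_irr. Qed.

Definition induced : sgraph := SGraph induced_adj_sym induced_adj_irr.
End Induced.

Section Tensor.
Variables G H : sgraph.

Definition tensor_adj : rel (G * H) :=
  fun u v => adj u.1 v.1 && adj u.2 v.2.

Lemma tensor_adj_sym : symmetric tensor_adj.
Proof. by move=> u v; rewrite /tensor_adj adj_sym [adj u.2 _]adj_sym. Qed.

Lemma tensor_adj_irr : irreflexive tensor_adj.
Proof. by move=> u; rewrite /tensor_adj adj_irr. Qed.

Definition tensor : sgraph := SGraph tensor_adj_sym tensor_adj_irr.
End Tensor.

(* A vertex of K_{m_0,...,m_{k-1}} is a pair (i, j): the j-th element of the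
   i-th partite set, where j ranges over 'I_(m i); [tag] returns i. *)
Section Multipartite.
Variables (k : nat) (m : 'I_k -> nat).

Definition multipartite_adj : rel {i : 'I_k & 'I_(m i)} :=
  fun u v => tag u != tag v.

Lemma multipartite_adj_sym : symmetric multipartite_adj.
Proof. by move=> u v; rewrite /multipartite_adj eq_sym. Qed.

Lemma multipartite_adj_irr : irreflexive multipartite_adj.
Proof. by move=> u; rewrite /multipartite_adj eqxx. Qed.

Definition complete_multipartite : sgraph :=
  SGraph multipartite_adj_sym multipartite_adj_irr.
End Multipartite.

Section PowerDomination.
Variable X : sgraph.

Definition nbhd (v : X) : {set X} := [set w | adj v w].

Definition closed_nbhd_set (S : {set X}) : {set X} :=
  S :|: \bigcup_(v in S) nbhd v.

(* One propagation step: some v in M has w as its unique neighbour outside M,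
   and w is added to M. *)
Definition propagates (M M' : {set X}) : bool :=
  [exists v in M, exists w : X,
     (nbhd v :\: M == [set w]) && (M' == w |: M)].

(* Propagation steps only enlarge M, and a vertex that can be added remains
   addable (or is already in M) after any other step; so the final set does not
   depend on the order of the steps, and it is V(X) iff V(X) is reachable. *)
Definition power_dominating (S : {set X}) : bool :=
  connect propagates (closed_nbhd_set S) [set: X].

Definition connected_power_dominating (S : {set X}) : bool :=
  power_dominating S && connected_graph (induced S).

(* #|X|.+1 is a default value, attained only if X has no connected power
   dominating set. *)
Definition gamma_Pc : nat :=
  \big[minn/#|X|.+1]_(S : {set X} | connected_power_dominating S) #|S|.
End PowerDomination.

(* Main.v *)
Require Import Defs.
From mathcomp Require Import all_boot.

(* Lower bounds come from forts: nonempty sets F such that no vertex outside F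
   has exactly one neighbour in F; a set whose closed neighbourhood misses a
   fort is not power dominating.  Two vertices (g, p), (g, p') with p, p' in the
   same partite set are twins, hence form a fort.  Upper bounds: if u, u' are
   universal and b, d, e lie in three distinct partite sets, then (u, b) and
   (u', d) dominate everything except {u} x part(d) and {u'} x part(b). *)

Set Implicit Arguments.
Unset Strict Implicit.
Unset Printing Implicit Defensive.

(** * Power domination and small connected sets in an arbitrary graph *)

Section PowerDominationFacts.
Variable X : sgraph.
Implicit Types (S M F : {set X}) (u v w : X).

Lemma gamma_PcP S n :
    connected_power_dominating S -> #|S| = n ->
    (forall T : {set X}, connected_power_dominating T -> n <= #|T|) ->
  gamma_Pc X = n.
Proof.
move=> cpS cardS minS; apply/eqP; rewrite eqn_leq; apply/andP; split.
  rewrite /gamma_Pc; elim: index_enum (mem_index_enum S) => // T s IHs.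
  rewrite inE big_cons => /orP[/eqP <-|/IHs les]; first by rewrite cpS cardS geq_minl.
  by case: ifP => // _; rewrite geq_min les orbT.
rewrite /gamma_Pc; elim/big_ind: _ => [|x y lex ley|T /minS //].
  (* The default value [#|X|.+1] is also at least [n], since [n] is the size of the subset [S] of
     [X]. *)
  by rewrite -cardS (leq_trans (max_card _)).
by rewrite leq_min lex.
Qed.

Lemma in_closed_nbhd_set S v :
  (v \in closed_nbhd_set S) = (v \in S) || [exists w in S, adj w v].
Proof.
rewrite inE; congr (_ || _); apply/bigcupP/exists_inP.
  by case=> w wS; rewrite inE; exists w.
by case=> w wS wv; exists w; rewrite ?inE.
Qed.

Definition fort F :=
  forall v w, v \notin F -> w \in F -> adj v w ->
  exists w', [/\ w' \in F, w' != w & adj v w'].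

(** Disjointness from [F] is invariant under propagation: the vertex [v] that would force some [z]
    in [F] lies outside [F], so it has a second neighbour in [F], which is missing from [M] as
    well. *)
Lemma fort_not_power_dominating F S w :
    fort F -> w \in F -> {in F, forall v, v \notin closed_nbhd_set S} ->
  ~~ power_dominating S.
Proof.
move=> fF wF disF; apply/negP => /connectP[s].
move: (closed_nbhd_set S) disF => M; elim: s M => [|M' s IHs] M disF /=.
  by move=> _ defM; have := disF w wF; rewrite -defM inE.
case/andP=> /exists_inP[v vM /existsP[z /andP[/eqP vMz /eqP ->]]].
apply: IHs => y yF; rewrite inE negb_or disF // andbT inE.
apply: contraTneq yF => ->; apply/negP => zF.
have /[!inE]/andP[_ vz] : z \in nbhd v :\: M by rewrite vMz inE.
have vF : v \notin F by apply: contraL vM => /disF.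
have [z' [z'F zz' vz']] := fF v z vF zF vz.
have : z' \in nbhd v :\: M by rewrite !inE disF.
by rewrite vMz inE (negPf zz').
Qed.

Lemma propagates_add M v w :
    v \in M -> adj v w -> w \notin M ->
    (forall z, z \notin M -> adj v z -> z = w) ->
  propagates M (w |: M).
Proof.
move=> vM vw wM uniq_w; apply/exists_inP; exists v => //.
apply/existsP; exists w; rewrite eqxx andbT; apply/eqP/setP=> z.
rewrite !inE; apply/andP/eqP => [[zM vz]|->]; first exact: uniq_w.
by [].
Qed.

Lemma star_connected S c :
  c \in S -> {in S, forall v, v != c -> adj c v} -> connected_graph (induced S).
Proof.
move=> cS cadj; apply/andP; split; first by apply/card_gt0P; exists (Sub c cS).
have from_c (x : induced S) : connect (@adj (induced S)) (Sub c cS) x.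
  have [<-|xc] := eqVneq x (Sub c cS); first exact: connect0.
  by apply: connect1; apply: cadj (valP x) _.
have csym : connect_sym (@adj (induced S)) by apply/sym_connect_sym/adj_sym.
by apply/forallP=> x; apply/forallP=> y; apply: connect_trans (from_c y); rewrite csym.
Qed.

Lemma connected_set2_adj v w :
  v != w -> connected_graph (induced [set v; w]) -> adj v w.
Proof.
move=> vw /andP[_ /forallP conn].
have vS : v \in [set v; w] by rewrite set21.
have wS : w \in [set v; w] by rewrite set22.
(* The first edge of a path from [v] to [w] must end at [w], because there are no loops. *)
have /connectP[[|x s] /=] := forallP (conn (Sub v vS)) (Sub w wS).
  by move=> _ /(congr1 val)/= wv; rewrite wv eqxx in vw.
case/andP=> vx _ _; have vx' : adj v (val x) := vx.
have /set2P[xv|xw] := valP x; last by rewrite -xw.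
by rewrite xv adj_irr in vx'.
Qed.

Lemma connected_induced_neq0 S : connected_graph (induced S) -> 0 < #|S|.
Proof.
by case/andP=> /card_gt0P[x _] _; apply/card_gt0P; exists (val x); apply: valP.
Qed.

Lemma universal_adj v w : universal v -> w != v -> adj v w.
Proof. by move=> /forallP/(_ w)/implyP. Qed.

End PowerDominationFacts.

(** * The tensor product: choice of vertices in the partite sets *)

Section TensorMultipartite.
Variables (G : sgraph) (k : nat) (m : 'I_k -> nat).
Local Notation H := (complete_multipartite m).
Local Notation X := (tensor G H).
Local Notation pt a b := ((a, b) : X).
Hypothesis m_gt0 : forall i, 0 < m i.
Hypothesis k_ge3 : 2 < k.
Variables (u u' : G).
Hypotheses (univ_u : universal u) (univ_u' : universal u') (uu' : u != u').

Lemma adj_tensorE (a c : G) (b d : H) :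
  @adj X (a, b) (c, d) = adj a c && (tag b != tag d).
Proof. by []. Qed.

Lemma exists_in_part (i : 'I_k) : exists y : H, tag y = i.
Proof. by exists (Tagged (fun i => 'I_(m i)) (Ordinal (m_gt0 i))). Qed.

Lemma exists_third_part (i j : 'I_k) : exists y : H, (tag y != i) && (tag y != j).
Proof.
have : 0 < #|~: [set i; j]|.
  rewrite cardsCs setCK card_ord subn_gt0 (leq_ltn_trans _ k_ge3) //.
  by rewrite cards2; case: eqP.
case/card_gt0P=> l; rewrite !inE negb_or => hl.
by have [y yl] := exists_in_part l; exists y; rewrite yl.
Qed.

Lemma exists_twin (i : 'I_k) :
  1 < m i -> exists p p' : H, [/\ p != p', tag p = i & tag p' = i].
Proof.
move=> mi; pose T j := 'I_(m j).
exists (Tagged T (Ordinal (m_gt0 i))), (Tagged T (Ordinal mi)); split=> //.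
by rewrite -tag_eqE /tag_eq eqxx /= tagged_asE.
Qed.

Lemma singleton_part (y y' : H) : tag y = tag y' -> m (tag y) = 1 -> y = y'.
Proof.
case: y y' => [i y] [j y'] /= ij; case: _ / ij y' => y' mi.
by congr existT; apply/ord_inj; move: y y'; rewrite mi => y y'; rewrite !ord1.
Qed.

(** * Lower bounds: one vertex, and two adjacent vertices *)

Lemma twin_fort (g : G) (p p' : H) :
  p != p' -> tag p = tag p' -> fort [set pt g p; pt g p'].
Proof.
move=> pp' tpp' [x y] w _ /set2P[] -> gxy.
  exists (g, p'); rewrite set22; split=> //; first by rewrite xpair_eqE eqxx eq_sym.
  by move: gxy; rewrite !adj_tensorE tpp'.
exists (g, p); rewrite set21; split=> //; first by rewrite xpair_eqE eqxx.
by move: gxy; rewrite !adj_tensorE tpp'.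
Qed.

(** One of [u], [u'] serves unless they are exactly [a] and [x]; in that case [x] is universal and
    any third vertex serves. *)
Lemma exists_other_neighbour (a x : G) :
  2 < #|G| -> x != a -> exists x', (x' != a) && adj x x'.
Proof.
move=> G3 xa.
have univ_adj v : universal v -> v != x -> adj x v.
  by move=> univ_v vx; rewrite adj_sym universal_adj // eq_sym.
have [ua|ua] := boolP ((u != a) && (u != x)).
  by case/andP: ua => ua ux; exists u; rewrite ua univ_adj.
have [u'a|u'a] := boolP ((u' != a) && (u' != x)).
  by case/andP: u'a => u'a u'x; exists u'; rewrite u'a univ_adj.
have univ_x : universal x.
  move: ua u'a; rewrite !negb_and !negbK => /orP[/eqP ua|/eqP <- //].
  by case/orP=> /eqP u'a; [case/eqP: uu'; rewrite ua | rewrite -u'a].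
have : 0 < #|~: [set a; x]|.
  rewrite cardsCs setCK subn_gt0 (leq_ltn_trans _ G3) //.
  by rewrite cards2; case: eqP.
case/card_gt0P=> w; rewrite !inE negb_or => /andP[wa wx].
by exists w; rewrite wa universal_adj.
Qed.

(** With [s = (a, b)], no vertex of the copy of [H] over [a] other than [s] is dominated. If two
    twins of [H] differ from [b], they give a fort there. Otherwise the whole complement of the
    closed neighbourhood of [s] is a fort. *)
Lemma set1_not_power_dominating (s : X) :
  (#|G| = 2 -> 3 < #|H|) -> ~~ power_dominating [set s].
Proof.
case: s => a b hG2.
have in_nbhd (x : G) (y : H) : (pt x y \in closed_nbhd_set [set pt a b]) =
    ((x, y) == (a, b)) || adj a x && (tag b != tag y).
  rewrite in_closed_nbhd_set inE; congr (_ || _).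
  apply/exists_inP/idP => [[w /set1P -> //]|h].
  by exists (a, b); rewrite ?set11.
have [/existsP[p /existsP[p' /and4P[pp' /eqP tpp' pb p'b]]]|no_twin] :=
    boolP [exists p : H, exists p' : H,
             [&& p != p', tag p == tag p', p != b & p' != b]].
  apply: (@fort_not_power_dominating X _ _ (a, p) (@twin_fort a _ _ pp' tpp')).
    by rewrite set21.
  by move=> v /set2P[] ->; rewrite in_nbhd adj_irr xpair_eqE ?(negPf pb) ?(negPf p'b) andbF.
have {}no_twin (p p' : H) : p != p' -> p != b -> p' != b -> tag p != tag p'.
  move=> pp' pb p'b; apply: contra no_twin => tpp'.
  by apply/existsP; exists p; apply/existsP; exists p'; apply/and4P.
pose F : {set X} := ~: closed_nbhd_set [set pt a b].
have inF_a (y : H) : y != b -> pt a y \in F.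
  by move=> yb; rewrite inE in_nbhd xpair_eqE eqxx (negPf yb) adj_irr.
(* With equal arguments this yields a vertex outside the part of [b]. *)
have [y0 /andP[y0b _]] := exists_third_part (tag b) (tag b).
have neq_tag (y : H) : tag y != tag b -> y != b by apply: contraNneq => ->.
apply: (@fort_not_power_dominating X F _ (a, y0)); last 2 first.
- exact/inF_a/neq_tag.
- by move=> v; rewrite inE.
(* The vertex [(a, b)] itself has no neighbour in [F]; a neighbour [(x, y)] of it will be shown to
   have two. *)
move=> [x y] w; rewrite inE negbK in_nbhd => /orP[/eqP ->|/andP[ax yb]] wF vw.
  case: w wF vw => x1 y1 /[swap]; rewrite adj_tensorE => h.
  by rewrite inE in_nbhd h orbT.
have xa : x != a by apply: contraTneq ax => ->; rewrite adj_irr.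
suff [w1 [w2 [w1F w2F w12 xw1 xw2]]] : exists w1 w2 : X,
    [/\ w1 \in F, w2 \in F, w1 != w2, @adj X (x, y) w1 & @adj X (x, y) w2].
  have [w1w|w1w] := eqVneq w1 w; last by exists w1.
  by exists w2; rewrite -w1w eq_sym.
have G2 : 1 < #|G| by apply/card_gt1P; exists u, u'.
(* When [G] has two vertices, [H] has at least four, so two of them avoid [b] and [y]; by [no_twin]
   neither lies in the part of [y], and both neighbours can be taken over [a]. *)
move: G2; rewrite leq_eqVlt => /orP[/eqP/esym/hG2 H4|G3].
  have : 1 < #|~: [set b; y]|.
    rewrite cardsCs setCK ltn_subRL (leq_ltn_trans _ H4) // addn1 ltnS.
    by rewrite cards2; case: eqP.
  case/card_gt1P=> y1 [y2 []]; rewrite !inE !negb_or.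
  move=> /andP[y1b y1y] /andP[y2b y2y] y12; exists (a, y1), (a, y2).
  rewrite !inF_a // xpair_eqE (negPf y12) andbF !adj_tensorE adj_sym ax.
  have yb' : y != b by apply: contraNneq yb => ->.
  by rewrite !no_twin // eq_sym.
have [x' /andP[x'a xx']] := exists_other_neighbour G3 xa.
have [y' /andP[y'b y'y]] := exists_third_part (tag b) (tag y).
(* The vertex [(x', b)] is undominated because its second coordinate is [b] and [x'] differs from
   [a]. *)
exists (a, y'), (x', b); rewrite inF_a ?neq_tag // !adj_tensorE adj_sym ax xx' /=.
rewrite inE in_nbhd !xpair_eqE (negPf x'a) /= eqxx andbF.
by rewrite (eq_sym a) (negPf x'a) [tag y == tag y']eq_sym [tag y == tag b]eq_sym y'y yb.
Qed.

(** Connectedness makes the two vertices adjacent, so their second coordinates lie in different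
    parts, one of which contains twins. *)
Lemma connected_set2_not_power_dominating (S : {set X}) :
    (forall i j, i != j -> 1 < m i \/ 1 < m j) ->
    #|S| = 2 -> connected_graph (induced S) ->
  ~~ power_dominating S.
Proof.
move=> big_part /eqP/cards2P[[a b] [[c d] [ne ->]]] /(connected_set2_adj ne).
rewrite adj_tensorE => /andP[ac bd].
have neq_ac : a != c by apply: contraTneq ac => ->; rewrite adj_irr.
(* A twin pair in {a} x part(d), or in {c} x part(b), is not dominated. *)
have undominated (a1 c1 : G) (b1 d1 : H) (S' := [set pt a1 b1; pt c1 d1]) :
    a1 != c1 -> tag b1 != tag d1 -> 1 < m (tag d1) -> ~~ power_dominating S'.
  move=> a1c1 b1d1 /exists_twin[p [p' [pp' tp tp']]].
  have tpp' : tag p = tag p' by rewrite tp.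
  apply: (@fort_not_power_dominating X _ _ (a1, p) (@twin_fort a1 _ _ pp' tpp')).
    by rewrite set21.
  have out (q : H) : tag q = tag d1 -> pt a1 q \notin closed_nbhd_set S'.
    move=> tq; rewrite in_closed_nbhd_set negb_or !inE !xpair_eqE (negPf a1c1) eqxx /=.
    rewrite orbF; apply/andP; split.
      by apply: contraNneq b1d1 => <-; rewrite tq.
    apply/exists_inP=> -[w /set2P[] ->]; first by rewrite /tensor_adj /= adj_irr.
    by rewrite /tensor_adj /= /multipartite_adj tq eqxx andbF.
  by move=> v /set2P[] ->; apply: out.
have [mb|md] := big_part _ _ bd; last exact: undominated.
by rewrite setUC; apply: undominated; rewrite 1?eq_sym.
Qed.

(** * Upper bounds: explicit connected power dominating sets *)

Lemma not_dominated_pair (S : {set X}) (b d : H) (x : G) (y : H) :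
    pt u b \in S -> pt u' d \in S -> tag b != tag d ->
    pt x y \notin closed_nbhd_set S ->
  (x = u /\ tag y = tag d) \/ (x = u' /\ tag y = tag b).
Proof.
move=> ubS u'dS bd; rewrite in_closed_nbhd_set negb_or => /andP[_ /exists_inPn noadj].
have := noadj _ ubS; have := noadj _ u'dS; rewrite !adj_tensorE.
have [->|xu] := eqVneq x u.
  by rewrite (universal_adj univ_u') // negbK => /eqP ->; left.
have [->|xu'] := eqVneq x u'.
  by rewrite (universal_adj univ_u) 1?eq_sym // negbK => _ /eqP ->; right.
(* Here both [u] and [u'] are adjacent to [x], so [y] would lie in the parts of both [b] and [d]. *)
rewrite (universal_adj univ_u) // (universal_adj univ_u') // !negbK => /eqP dy /eqP yb.
by rewrite yb dy eqxx in bd.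
Qed.

(** Only [(u, d)] and [(u', b)] are undominated. For [e] in a third part, [(u', e)] forces the first
    and then [(u, e)] forces the second. *)
Lemma cpd_set2 (b d : H) :
    tag b != tag d -> m (tag b) = 1 -> m (tag d) = 1 ->
  connected_power_dominating [set pt u b; pt u' d].
Proof.
move=> bd mb md; set S := [set _; _].
have ubS : pt u b \in S by rewrite set21.
have u'dS : pt u' d \in S by rewrite set22.
have adj_uu' : adj u u' by rewrite universal_adj // eq_sym.
have u'u : u' != u by rewrite eq_sym.
apply/andP; split; last first.
  apply: (star_connected ubS) => v /set2P[] ->; first by rewrite eqxx.
  by rewrite adj_tensorE adj_uu' bd.
set M := closed_nbhd_set S.
have missing (z : X) : z \notin M -> z = (u, d) \/ z = (u', b).
  case: z => x y /(not_dominated_pair ubS u'dS bd)[] [-> ty]; [left|right].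
    by rewrite (@singleton_part y d) ?ty.
  by rewrite (@singleton_part y b) ?ty.
have outM (x : G) (y : H) : (x, y) != (u, b) -> (x, y) != (u', d) ->
    ~~ (adj u x && (tag b != tag y)) -> ~~ (adj u' x && (tag d != tag y)) ->
    pt x y \notin M.
  move=> h1 h2 h3 h4; rewrite in_closed_nbhd_set negb_or in_set2 negb_or h1 h2 /=.
  by apply/exists_inPn=> w /set2P[] ->.
have db : d != b by apply: contraNneq bd => ->.
have udM : pt u d \notin M.
  by apply: outM; rewrite ?xpair_eqE ?(negPf uu') ?(negPf db) ?adj_irr ?eqxx ?andbF.
have u'bM : pt u' b \notin M.
  apply: outM; rewrite ?xpair_eqE ?adj_irr ?eqxx ?andbF // ?(negPf u'u) //=.
  by rewrite eq_sym (negPf db).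
have [e /andP[eb ed]] := exists_third_part (tag b) (tag d).
have inM (z : X) : z <> (u, d) -> z <> (u', b) -> z \in M.
  by move=> h1 h2; apply: contraT => /missing[].
have ueM : pt u e \in M.
  by apply: inM => -[] => [ed'|uu'' _]; [rewrite ed' eqxx in ed | case/eqP: uu'].
have u'eM : pt u' e \in M.
  by apply: inM => -[] => [uu'' _|ed']; [case/eqP: uu' | rewrite ed' eqxx in eb].
have step1 : propagates M (pt u d |: M).
  apply: (propagates_add u'eM) => //; first by rewrite adj_tensorE adj_sym adj_uu' ed.
  by move=> z /missing[] -> //; rewrite adj_tensorE adj_irr.
have step2 : propagates (pt u d |: M) [set: X].
  have -> : [set: X] = pt u' b |: (pt u d |: M).
    apply/setP=> z; rewrite in_setT !in_setU1; apply/esym.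
    by have [//|/missing[] ->] := boolP (z \in M); rewrite ?orbT ?eqxx ?orbT.
  apply: (@propagates_add X _ (u, e)); rewrite ?in_setU1 ?ueM ?orbT //.
  - by rewrite adj_tensorE adj_uu' eb.
  - by rewrite negb_or u'bM xpair_eqE (negPf u'u).
  - move=> z; rewrite in_setU1 negb_or => /andP[zud /missing[] // zud'].
    by rewrite zud' eqxx in zud.
exact: connect_trans (connect1 step1) (connect1 step2).
Qed.

(** The vertex [(u', e)] dominates [u] times the part of [d], so at most [(u', b)] is left, and
    [(u, e)] forces it. *)
Lemma cpd_set3_singleton (b d e : H) :
    tag b != tag d -> tag e != tag b -> tag e != tag d -> m (tag b) = 1 ->
  connected_power_dominating [set pt u b; pt u' d; pt u' e].
Proof.
move=> bd eb ed mb; set S := [set _; _; _].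
have ubS : pt u b \in S by rewrite !inE eqxx.
have u'dS : pt u' d \in S by rewrite !inE eqxx orbT.
have u'eS : pt u' e \in S by rewrite !inE eqxx orbT.
have adj_uu' : adj u u' by rewrite universal_adj // eq_sym.
apply/andP; split; last first.
  apply: (star_connected ubS) => v; rewrite !inE => /orP[/orP[]|] /eqP ->.
  - by rewrite eqxx.
  - by rewrite adj_tensorE adj_uu' bd.
  - by rewrite adj_tensorE adj_uu' [tag b == _]eq_sym eb.
set M := closed_nbhd_set S.
have missing (z : X) : z \notin M -> z = (u', b).
  case: z => x y zM; have [[xu ty]|[-> ty]] := not_dominated_pair ubS u'dS bd zM.
    case/negP: zM; rewrite in_closed_nbhd_set; apply/orP; right.
    by apply/exists_inP; exists (u', e); rewrite // adj_tensorE xu adj_sym adj_uu' ty.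
  by rewrite (@singleton_part y b) ?ty.
(* A propagation step needs a missing vertex; the case split avoids proving that [(u', b)] is
   undominated. *)
have [u'bM|u'bM] := boolP (pt u' b \in M).
  suff MT : M = [set: X] by rewrite /power_dominating -/M MT.
  apply/eqP; rewrite -subTset; apply/subsetP=> z _; apply: contraT => zM.
  by case/negP: (zM); rewrite (missing z zM).
have ueM : pt u e \in M.
  by apply: contraT => /missing[uu'']; case/eqP: uu'.
apply: connect1.
have -> : [set: X] = pt u' b |: M.
  apply/setP=> z; rewrite in_setT !in_setU1; apply/esym.
  by have [//|/missing ->] := boolP (z \in M); rewrite ?orbT ?eqxx.
apply: (propagates_add ueM) => //; first by rewrite adj_tensorE adj_uu' eb.
by move=> z /missing.
Qed.

(** The vertex [(w, e)] is adjacent to everything that the first two leave undominated, so the set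
    dominates without propagation, whatever the part sizes. *)
Lemma cpd_set3_triangle (w : G) (b d e : H) :
    w != u -> w != u' -> tag b != tag d -> tag e != tag b -> tag e != tag d ->
  connected_power_dominating [set pt u b; pt u' d; pt w e].
Proof.
move=> wu wu' bd eb ed; set S := [set _; _; _].
have ubS : pt u b \in S by rewrite !inE eqxx.
have u'dS : pt u' d \in S by rewrite !inE eqxx orbT.
have weS : pt w e \in S by rewrite !inE eqxx orbT.
have adj_uw : adj u w by rewrite universal_adj.
have adj_u'w : adj u' w by rewrite universal_adj.
apply/andP; split; last first.
  apply: (star_connected ubS) => v; rewrite !inE => /orP[/orP[]|] /eqP ->.
  - by rewrite eqxx.
  - by rewrite adj_tensorE universal_adj // eq_sym.
  - by rewrite adj_tensorE adj_uw [tag b == _]eq_sym eb.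
suff MT : closed_nbhd_set S = [set: X] by rewrite /power_dominating MT.
apply/eqP; rewrite -subTset; apply/subsetP=> -[x y] _; apply: contraT => zM.
suff /exists_inP wxy : exists2 v, v \in S & @adj X v (x, y).
  by rewrite in_closed_nbhd_set wxy orbT in zM.
exists (w, e) => //; rewrite adj_tensorE adj_sym.
by have [[-> ->]|[-> ->]] := not_dominated_pair ubS u'dS bd zM;
  rewrite ?adj_uw ?adj_u'w.
Qed.

End TensorMultipartite.

(** * The value for a sorted tuple of part sizes *)

Lemma card_multipartite (k : nat) (m : k.-tuple nat) :
  #|complete_multipartite (tnth m)| = sumn m.
Proof.
rewrite card_tagged -[in RHS](map_tnth_enum m); congr sumn.
by apply: eq_map => i; rewrite card_ord.
Qed.

(* The partite sets are numbered from 0: m_1 = nth 0 m 0 and m_2 = nth 0 m 1.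
   Hypothesis hK2 excludes exactly the degenerate products for which the formula
   is false: G = K_2 with m_1 >= 2 (the value is 4) and K_2 x K_{1,1,1} = C_6
   (the value is 1). It holds vacuously as soon as G has 3 vertices. *)
Theorem theorem15 (G : sgraph) (k : nat) (m : k.-tuple nat)
    (hconn : connected_graph G)
    (huniv : 2 <= #|[set v : G | universal v]|)
    (hk : 3 <= k)
    (hpos : forall i : 'I_k, 1 <= tnth m i)
    (hsorted : sorted leq m)
    (hK2 : #|G| = 2 -> nth 0 m 0 = 1 /\ 3 < sumn m) :
  gamma_Pc (tensor G (complete_multipartite (tnth m))) =
    if (nth 0 m 0 == 1) && (nth 0 m 1 == 1) then 2 else 3.
Proof.
have [u [u' [/[!inE] univ_u univ_u' uu']]] := card_gt1P huniv.
have hH4 : #|G| = 2 -> 3 < #|complete_multipartite (tnth m)|.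
  by rewrite card_multipartite => /hK2[].
pose i0 := Ordinal (ltn_trans (isT : 0 < 2) hk).
pose i1 := Ordinal (ltn_trans (isT : 1 < 2) hk).
have [b tb] := exists_in_part hpos i0.
have [d td] := exists_in_part hpos i1.
have bd : tag b != tag d by rewrite tb td.
have [e /andP[eb ed]] := exists_third_part hpos hk (tag b) (tag d).
have m0 : nth 0 m 0 = tnth m (tag b) by rewrite tb (tnth_nth 0).
have m1 : nth 0 m 1 = tnth m (tag d) by rewrite td (tnth_nth 0).
have ge2 (T : {set tensor G (complete_multipartite (tnth m))}) :
    connected_power_dominating T -> 1 < #|T|.
  case/andP=> pdT /connected_induced_neq0 T0; rewrite ltn_neqAle T0 andbT eq_sym.
  apply/negP=> /cards1P[s defT]; move: pdT; apply/negP; rewrite defT.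
  exact: (set1_not_power_dominating hpos hk univ_u univ_u' uu').
case: ifP => [/andP[/eqP m0_1 /eqP m1_1]|m01].
  apply: (gamma_PcP (@cpd_set2 _ _ _ hpos hk _ _ univ_u univ_u' uu' b d bd _ _)) => //.
  - by rewrite -m0.
  - by rewrite -m1.
  - by rewrite cards2 xpair_eqE (negPf uu').
have mono (i j : 'I_k) : i <= j -> tnth m i <= tnth m j.
  move=> ij; rewrite !(tnth_nth 0).
  by apply: (sorted_leq_nth leq_trans leqnn) => //; rewrite inE size_tuple.
(* If two parts [i < j] were singletons, then, as [0 <= i] and [1 <= j], sortedness would make the
   first two parts singletons. *)
have big_part (i j : 'I_k) : i != j -> 1 < tnth m i \/ 1 < tnth m j.
  wlog ij : i j / i < j => [th|_].
    rewrite neq_ltn => /orP[] ij; last apply/or_comm.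
      by apply: th; rewrite ?neq_ltn ?ij.
    by apply: th; rewrite ?neq_ltn ?ij.
  have [|mj] := ltnP 1 (tnth m j); [by right | left].
  rewrite ltnNge; apply: contraFN m01 => mi.
  rewrite m0 m1 !eqn_leq !hpos !andbT tb td.
  by rewrite (leq_trans (mono i0 i (leq0n i)) mi)
    (leq_trans (mono i1 j (leq_ltn_trans (leq0n i) ij)) mj).
have ge3 (T : {set tensor G (complete_multipartite (tnth m))}) :
    connected_power_dominating T -> 2 < #|T|.
  move=> cpT; rewrite ltn_neqAle ge2 // andbT; apply/eqP => /esym T2.
  case/andP: cpT => + conn; apply/negP.
  exact: connected_set2_not_power_dominating big_part T2 conn.
have G2 : 1 < #|G| by apply/card_gt1P; exists u, u'.
have de : d != e by apply: contraNneq ed => ->.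
(* When [G] has two vertices, [hK2] makes the part of [b] a singleton; otherwise a third vertex [w]
   of [G] is available. *)
move: G2; rewrite leq_eqVlt => /orP[/eqP/esym/hK2[m0_1 _]|G3].
  rewrite m0 in m0_1.
  apply: (gamma_PcP (cpd_set3_singleton univ_u univ_u' uu' bd eb ed m0_1)) => //.
  by rewrite -setUA cardsU1 cards2 !inE !xpair_eqE (negPf uu') eqxx de.
have : 0 < #|~: [set u; u']| by rewrite cardsCs setCK subn_gt0 cards2 uu'.
case/card_gt0P=> w; rewrite !inE negb_or => /andP[wu wu'].
apply: (gamma_PcP (cpd_set3_triangle univ_u univ_u' uu' wu wu' bd eb ed)) => //.
rewrite -setUA cardsU1 cards2 !inE !xpair_eqE (negPf uu').
by rewrite [u == w]eq_sym (negPf wu) [u' == w]eq_sym (negPf wu').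
Qed.
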